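(* Consider two-color Babylon played with $p$ chips of one color and $q$ chips of the other color, where $1 \le p \le q$. The second player has a winning strategy if and only if $p+q$ is even and $p \ge 3$; otherwise the first player has a winning strategy.
   Context: Two-color Babylon: the game starts with $n=p+q$ chips, each of one of two colors (red or blue), each chip forming its own stack of height $1$. Two players (the first player, Alice, and the second player, Bob) alternate moves; a move consists of choosing two distinct stacks that have the same height or the same color of top chip (or both) and placing one of them entirely on top of the other, forming a single stack. The color of a stack is the color of its top chip. The last player to make a legal move wins. *)

(* Defs.v *)
From HB Require Import structures.
From mathcomp Require Import all_boot.

Set Implicit Arguments.
Unset Strict Implicit.
Unset Printing Implicit Defensive.

Inductive color := Red | Blue.

Definition color_to_bool (c : color) : bool := if c is Red then true else false.
Definition bool_to_color (b : bool) : color := if b then Red else Blue.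
Fact color_to_boolK : cancel color_to_bool bool_to_color. Proof. by case. Qed.
HB.instance Definition _ := Equality.copy color (can_type color_to_boolK).

(* The chips of a stack are listed from top to bottom, so the height is the   *)
(* [size], the color is the [ohead], and [s ++ t] is [s] put on top of [t].   *)
Definition stack := seq color.
Definition height (s : stack) : nat := size s.
Definition top_color (s : stack) : option color := ohead s.

(* A finite multiset of stacks: [legal_move] is invariant under reordering of *)
(* the lists.                                                                 *)
Definition position := seq stack.

Definition initial_position (c d : color) (p q : nat) : position :=
  nseq p [:: c] ++ nseq q [:: d].

Definition compatible (s t : stack) : Prop :=
  height s = height t \/ top_color s = top_color t.

(* [s] and [t] are separate entries of [P] (distinct stacks, although they    *)
(* may be equal as lists of chips), and [s] is placed on top of [t].          *)
Definition legal_move (P Q : position) : Prop :=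
  exists (s t : stack) (R : position),
    [/\ perm_eq P [:: s, t & R], compatible s t & perm_eq Q ((s ++ t) :: R)].

Definition terminal (P : position) : Prop := forall Q, ~ legal_move P Q.

Inductive player := Alice | Bob.

(* Moves are numbered from 0. *)
Definition mover (k : nat) : player := if odd k then Bob else Alice.

(* Histories list the successive positions with the current one first, so     *)
(* that in the history [P :: h] exactly [size h] moves have been made.        *)
Definition history := seq position.

Definition strategy := history -> position.

(* The histories of the plays from [P0] in which [w] follows [sigma], the     *)
(* other player making arbitrary legal moves.                                 *)
Inductive follows (w : player) (sigma : strategy) (P0 : position) :
    history -> Prop :=
| follows_start : follows w sigma P0 [:: P0]
| follows_move (P Q : position) (h : history) :
    follows w sigma P0 (P :: h) ->
    legal_move P Q ->
    (mover (size h) = w -> Q = sigma (P :: h)) ->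
    follows w sigma P0 [:: Q, P & h].

Definition moved_last (w : player) (h : history) : Prop :=
  exists (Q P : position) (h' : history),
    h = [:: Q, P & h'] /\ mover (size h') = w.

(* The strategy must supply a legal move whenever [w] is to move and one      *)
(* exists, and every completed play must be won. There are no infinite plays: *)
(* each move lowers the number of stacks by one.                              *)
Definition winning_strategy (w : player) (sigma : strategy) (P0 : position) :
    Prop :=
  forall (P : position) (h : history), follows w sigma P0 (P :: h) ->
    (mover (size h) = w -> ~ terminal P -> legal_move P (sigma (P :: h))) /\
    (terminal P -> moved_last w (P :: h)).

Definition has_winning_strategy (w : player) (P0 : position) : Prop :=
  exists sigma : strategy, winning_strategy w sigma P0.

(* Main.v *)
(** Only the heights of the stacks of each color matter, and the play ends with
    one stack or with two stacks of different colors and heights. The number of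
    moves is fixed by which of the two occurs, so one player (the splitter)
    aims at two final stacks and the other (the merger) at a single one.
    Alice is the splitter for odd [p + q], Bob for even [p + q].

    The splitter keeps a tall "giant" in each color and answers every move so
    that one giant grows by 2 and all other stacks have height 1. For even
    [p + q] the giants keep a parity different from that of [(p + q) / 2], so
    that the final heights cannot agree. The families [good_Z1], ..., [good_33]
    are the exceptional answers, needed when the two colors threaten to become
    equal. Once a color has a single stack [d], the splitter can always keep
    [d] out of the other color ([good_single]). For even [p + q] and [p <= 2]
    the merger eliminates a color at once. *)

Require Import Defs.
From mathcomp Require Import all_boot zify.
From Stdlib Require Import ClassicalEpsilon.

Set Implicit Arguments.
Unset Strict Implicit.
Unset Printing Implicit Defensive.

(** * Moves on height multisets and the positions that the splitter maintains *)

Inductive step (R B R' B' : seq nat) : Prop :=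
| step_merge_l x y r of perm_eq R [:: x, y & r] & perm_eq R' (x + y :: r)
    & perm_eq B' B
| step_merge_r x y b of perm_eq B [:: x, y & b] & perm_eq B' (x + y :: b)
    & perm_eq R' R
| step_cross_l x r b of perm_eq R (x :: r) & perm_eq B (x :: b)
    & perm_eq R' (x + x :: r) & perm_eq B' b
| step_cross_r x r b of perm_eq R (x :: r) & perm_eq B (x :: b)
    & perm_eq R' r & perm_eq B' (x + x :: b).

Notation ones k := (nseq k 1).

Lemma step_sym R B R' B' : step R B R' B' -> step B R B' R'.
Proof.
case=> [x y r h1 h2 h3|x y b h1 h2 h3|x r b h1 h2 h3 h4|x r b h1 h2 h3 h4].
- exact: (step_merge_r h1 h2 h3).
- exact: (step_merge_l h1 h2 h3).
- exact: (step_cross_r h2 h1 h4 h3).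
exact: (step_cross_l h2 h1 h4 h3).
Qed.

Lemma step_perm R B R0 B0 R' B' : perm_eq R R0 -> perm_eq B B0 ->
  step R B R' B' -> step R0 B0 R' B'.
Proof.
rewrite perm_sym => hR hB.
case=> [x y r h1 h2 h3|x y b h1 h2 h3|x r b h1 h2 h3 h4|x r b h1 h2 h3 h4].
- by apply: (step_merge_l (x := x) (y := y) (r := r)); rewrite ?(perm_trans hR) ?(perm_trans h3).
- apply: (step_merge_r (x := x) (y := y) (b := b)) => //; last by rewrite (perm_trans h3) // perm_sym.
  by rewrite perm_sym in hB; rewrite (perm_trans hB).
- rewrite perm_sym in hB.
  by apply: (step_cross_l (x := x) (r := r) (b := b)); rewrite ?(perm_trans hR) ?(perm_trans hB).
rewrite perm_sym in hB.
by apply: (step_cross_r (x := x) (r := r) (b := b)); rewrite ?(perm_trans hR) ?(perm_trans hB).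
Qed.

(** The total is odd, so the giants never capture each other and two final stacks never agree; the
    only danger is the loss of a color. The last two conditions ensure that a giant left without
    ones is taller than 1, out of reach of the ones. *)
Record odd_giants (G k H m : nat) : Prop := OddGiants {
  _ : 0 < G; _ : 0 < H; _ : odd (G + H); _ : ~~ odd (k + m);
  _ : 1 < G \/ m < k; _ : 1 < H \/ k < m }.

(* With n = G + k + H + m chips, the congruence says that G and n / 2 have
   different parities. *)
Record even_giants (G k H m : nat) : Prop := EvenGiants {
  _ : 0 < G; _ : 0 < H; _ : ~~ odd (k + m); _ : (3 * G + H + k + m) %% 4 = 2;
  _ : 10 <= G + k + H + m; _ : 1 < G \/ 1 < k; _ : 1 < H \/ 1 < m;
  _ : 0 < k /\ 0 < m \/ G <> H; _ : G + k <> H + m \/ 2 < k /\ 2 < m }.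

(** The last condition of [good_single] prevents the merger from leaving four or more stacks that
    all have height [d / 2], where every merge would create a [d]. *)
Inductive good0 : seq nat -> seq nat -> Prop :=
| good_single d xs of 0 < d & all (leq 1) xs & odd (size xs)
    & d \notin xs & d != sumn xs
    & [|| has (fun e => d < 2 * e) xs, count (fun e => 2 * e == d) xs <= 2
        | all (fun e => 2 * e == d) xs] : good0 [:: d] xs
| good_odd_giants G k H m of odd_giants G k H m & 0 < k & 0 < m :
    good0 (G :: ones k) (H :: ones m)
| good_even_giants G k H m of even_giants G k H m & 0 < k & 0 < m :
    good0 (G :: ones k) (H :: ones m)
| good_Z1 G H b of 0 < G & 0 < H & ~~ odd b & G + 2 = H + b
    & 10 <= G + H + 4 + b :
    good0 [:: G; 2] [:: H, 2 & ones b]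
| good_Z1' G H b of 0 < G & 0 < H & ~~ odd b & G + 1 = H + b
    & 10 <= G + H + 3 + b :
    good0 [:: G; 1] [:: H, 2 & ones b]
| good_Z2 G H b of 1 < G & H = G + 3 & odd b : good0 [:: G; 2] (H :: ones b)
| good_Z3 H b of odd H & ~~ odd b & 8 <= 5 + H + b
    & H = 1 \/ ~~ odd ((5 + H + b)./2) : good0 [:: 2; 1] [:: H, 2 & ones b]
| good_Z4 G H b of 0 < H & odd b & G = H + b : good0 [:: G; 4] (H :: ones b)
| good_Z5 H b of odd H & H <> 3 & ~~ odd b & 8 < 7 + H + b :
    good0 [:: 2; 1] [:: H, 4 & ones b]
| good_Z6 H b of 5 <= H & odd b : good0 [:: 2; 2] (H :: ones b)
| good_Z7 b of odd b : good0 [:: 2; 1] (6 :: ones b)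
| good_33 : good0 [:: 2; 2] [:: 1; 1].

(* These positions have the merger to move. *)
Definition good R B := exists R0 B0,
  [/\ perm_eq R R0, perm_eq B B0 & good0 R0 B0 \/ good0 B0 R0].

(** The splitter is to move in [win], the merger in [safe]. A position where the merger is stuck is
    vacuously [safe], as it should be: the merger has lost. *)
Definition win R B := exists R' B', step R B R' B' /\ good R' B'.

Definition safe R B := forall R' B', step R B R' B' -> win R' B'.

Lemma good_sym R B : good R B -> good B R.
Proof. by case=> R0 [B0 [h1 h2 h3]]; exists B0, R0; split=> //; apply/or_comm. Qed.

Lemma goodI R B : good0 R B -> good R B.
Proof. by exists R, B; split=> //; left. Qed.

Lemma goodS R B : good0 B R -> good R B.
Proof. by move/goodI/good_sym. Qed.

Lemma good_perm R B R0 B0 : perm_eq R R0 -> perm_eq B B0 -> good R0 B0 -> good R B.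
Proof.
move=> h1 h2 [R1 [B1 [h3 h4 h5]]]; exists R1, B1.
by rewrite (perm_trans h1) // (perm_trans h2).
Qed.

Lemma win_sym R B : win R B -> win B R.
Proof.
by case=> R' [B' [h1 h2]]; exists B', R'; split; [exact: step_sym|exact: good_sym].
Qed.

Lemma win_perm R B R0 B0 : perm_eq R R0 -> perm_eq B B0 -> win R0 B0 -> win R B.
Proof.
rewrite perm_sym => h1; rewrite perm_sym => h2 [R' [B' [h3 h4]]].
by exists R', B'; split=> //; apply: step_perm h3.
Qed.

Lemma win_l x y r R B : perm_eq R [:: x, y & r] -> good (x + y :: r) B -> win R B.
Proof. by move=> h hg; exists (x + y :: r), B; split=> //; apply: step_merge_l h _ _. Qed.

Lemma win_r x y b R B : perm_eq B [:: x, y & b] -> good R (x + y :: b) -> win R B.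
Proof. by move=> h hg; exists R, (x + y :: b); split=> //; apply: step_merge_r h _ _. Qed.

Lemma win_xl x r b R B : perm_eq R (x :: r) -> perm_eq B (x :: b) ->
  good (x + x :: r) b -> win R B.
Proof. by move=> h1 h2 hg; exists (x + x :: r), b; split=> //; apply: step_cross_l h1 h2 _ _. Qed.

Lemma win_xr x r b R B : perm_eq R (x :: r) -> perm_eq B (x :: b) ->
  good r (x + x :: b) -> win R B.
Proof. by move=> h1 h2 hg; exists r, (x + x :: b); split=> //; apply: step_cross_r h1 h2 _ _. Qed.

Lemma safe_sym R B : safe R B -> safe B R.
Proof. by move=> h R' B' /step_sym /h /win_sym. Qed.

Lemma safe_perm R B R0 B0 : perm_eq R R0 -> perm_eq B B0 -> safe R0 B0 -> safe R B.
Proof. by move=> h1 h2 h R' B' /(step_perm h1 h2) /h. Qed.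

Lemma safeI R B :
  (forall x y r, perm_eq R [:: x, y & r] -> win (x + y :: r) B) ->
  (forall x y b, perm_eq B [:: x, y & b] -> win R (x + y :: b)) ->
  (forall x r b, perm_eq R (x :: r) -> perm_eq B (x :: b) ->
     win (x + x :: r) b /\ win r (x + x :: b)) ->
  safe R B.
Proof.
move=> hl hr hx R' B'.
case=> [x y r /hl w h2 h3|x y b /hr w h2 h3|x r b h1 h2 h3 h4|x r b h1 h2 h3 h4].
- exact: win_perm h2 h3 w.
- exact: win_perm h3 h2 w.
- exact: win_perm h3 h4 (hx _ _ _ h1 h2).1.
exact: win_perm h3 h4 (hx _ _ _ h1 h2).2.
Qed.

(** * Enumeration of the merger's moves when most stacks have height 1 *)

Lemma perm_cons_nseq (l : seq nat) k x r : perm_eq (l ++ ones k) (x :: r) ->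
  (x \in l /\ perm_eq r (rem x l ++ ones k)) \/
  [/\ x = 1, 0 < k & perm_eq r (l ++ ones k.-1)].
Proof.
move=> h; have: x \in l ++ ones k by rewrite (perm_mem h) mem_head.
rewrite mem_cat mem_nseq; case: (boolP (x \in l)) => [xl _|_ /= /andP[k0 /eqP x1]]; [left|right].
  split=> //; rewrite -(perm_cons x) perm_sym (perm_trans _ h) //.
  by rewrite -cat_cons perm_cat2r perm_sym perm_to_rem.
subst x; split=> //.
rewrite -(perm_cons 1) perm_sym (perm_trans _ h) //.
by case: k k0 {h} => // k _; rewrite /= -cat_rcons -cats1 -!cat_cons perm_cat2r perm_sym cats1 perm_rcons.
Qed.

(** Compares the counts of an arbitrary predicate. Its value at 1 gets multiplied by variables, so a
    case analysis on it leaves linear arithmetic. *)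
Ltac perms := apply/permP => ?; rewrite /= ?(addn1, addn2, addn3, addn4) /= ?count_nseq;
  repeat match goal with |- context [?f 1] =>
    is_var f; let b := fresh in set b := f 1; clearbody b; case: b end;
  rewrite ?mul1n ?mul0n /=; lia.

Lemma pick1 a k x r : perm_eq (a :: ones k) (x :: r) ->
  (x = a /\ perm_eq r (ones k)) \/
  [/\ x = 1, 0 < k & perm_eq r (a :: ones k.-1)].
Proof.
move/(@perm_cons_nseq [:: a]) => [[]|]; last by right.
by rewrite inE => /eqP -> /=; rewrite eqxx; left.
Qed.

Lemma pick2 a b k x r : perm_eq [:: a, b & ones k] (x :: r) ->
  [\/ x = a /\ perm_eq r (b :: ones k), x = b /\ perm_eq r (a :: ones k)
    | [/\ x = 1, 0 < k & perm_eq r [:: a, b & ones k.-1]]].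
Proof.
move/(@perm_cons_nseq [:: a; b]) => [[]|]; last by constructor 3.
rewrite !inE => /orP[/eqP ->|/eqP ->] /=.
  by rewrite eqxx; constructor 1.
by case: eqP => [->|_]; rewrite ?eqxx /=; constructor 2.
Qed.

Lemma pick0 k x r : perm_eq (ones k) (x :: r) ->
  [/\ x = 1, 0 < k & perm_eq r (ones k.-1)].
Proof. by move/(@perm_cons_nseq [::]) => [[]|]. Qed.

(** The parameter [W] hides the other color, so that one enumeration serves both colors. *)
Lemma merge1 (W : seq nat -> Prop) a k :
  (forall r r', perm_eq r r' -> W r' -> W r) ->
  (1 < k -> W [:: 2, a & ones k.-2]) ->
  (0 < k -> W (a + 1 :: ones k.-1)) ->
  forall x y r, perm_eq (a :: ones k) [:: x, y & r] -> W (x + y :: r).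
Proof.
move=> hW h2 h1 x y r /pick1[[->]|[-> k0]].
  by rewrite perm_sym => /pick0[-> k0 hr]; apply: hW (h1 k0); rewrite perm_cons.
rewrite perm_sym => /pick1[[-> hr]|[-> k1 hr]].
  by apply: hW (h1 k0); rewrite addnC perm_cons.
by apply: hW (h2 _); [rewrite perm_cons|lia].
Qed.

Lemma merge2 (W : seq nat -> Prop) a b k :
  (forall r r', perm_eq r r' -> W r' -> W r) ->
  (1 < k -> W [:: 2, a, b & ones k.-2]) ->
  (0 < k -> W [:: a + 1, b & ones k.-1]) ->
  (0 < k -> W [:: b + 1, a & ones k.-1]) ->
  W (a + b :: ones k) ->
  forall x y r, perm_eq [:: a, b & ones k] [:: x, y & r] -> W (x + y :: r).
Proof.
move=> hW h2 ha hb hab x y r /pick2[[->]|[->]|[-> k0]]; rewrite perm_sym.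
- move=> /pick1[[-> hr]|[-> k0 hr]].
    by apply: hW hab; rewrite perm_cons.
  by apply: hW (ha k0); rewrite perm_cons.
- move=> /pick1[[-> hr]|[-> k0 hr]].
    by apply: hW hab; rewrite addnC perm_cons.
  by apply: hW (hb k0); rewrite perm_cons.
move=> /pick2[[-> hr]|[-> hr]|[-> k1 hr]].
- by apply: hW (ha k0); rewrite addnC perm_cons.
- by apply: hW (hb k0); rewrite addnC perm_cons.
by apply: hW (h2 _); [rewrite perm_cons|lia].
Qed.

(** A giant of height 1 is interchangeable with a one, so its crossing with a one of the other color
    is covered by the premise on crossing ones. *)
Lemma safe11 a k c m :
  (1 < k -> win [:: 2, a & ones k.-2] (c :: ones m)) ->
  (0 < k -> win (a + 1 :: ones k.-1) (c :: ones m)) ->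
  (1 < m -> win (a :: ones k) [:: 2, c & ones m.-2]) ->
  (0 < m -> win (a :: ones k) (c + 1 :: ones m.-1)) ->
  (a = c -> win (a + a :: ones k) (ones m) /\ win (ones k) (a + a :: ones m)) ->
  (0 < k -> 0 < m -> win [:: 2, a & ones k.-1] (c :: ones m.-1) /\
                     win (a :: ones k.-1) [:: 2, c & ones m.-1]) ->
  0 < k -> 0 < m -> 
  safe (a :: ones k) (c :: ones m).
Proof.
move=> h1 h2 h3 h4 h5 h6 k0 m0; apply: safeI.
- by apply: (merge1 (W := fun r => win r _)) => // r r' h; apply: win_perm.
- by apply: (merge1 (W := fun r => win _ r)) => // r r' h; apply: win_perm.
have [h7 h8] := h6 k0 m0.
move=> x r b /pick1[[-> hr]|[-> _ hr]] /pick1[[e hb]|[e _ hb]].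
- case: (h5 e) => w1 w2; split; [apply: win_perm w1|apply: win_perm w2] => //; rewrite ?perm_cons //.
- subst a; split; [apply: win_perm h7|apply: win_perm h8] => //; rewrite ?perm_cons // (perm_trans hr) //; perms.
- subst c; split; [apply: win_perm h7|apply: win_perm h8] => //; rewrite ?perm_cons // (perm_trans hb) //; perms.
by split; [apply: win_perm h7|apply: win_perm h8] => //; rewrite ?perm_cons.
Qed.
Lemma safe21 a b c m :
  win [:: a + b] (c :: ones m) ->
  (1 < m -> win [:: a; b] [:: 2, c & ones m.-2]) ->
  (0 < m -> win [:: a; b] (c + 1 :: ones m.-1)) ->
  (a = c -> win [:: a + a; b] (ones m) /\ win [:: b] (a + a :: ones m)) ->
  (b = c -> win [:: b + b; a] (ones m) /\ win [:: a] (b + b :: ones m)) ->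
  (a = 1 -> 0 < m -> win [:: 2; b] (c :: ones m.-1) /\ win [:: b] [:: 2, c & ones m.-1]) ->
  (b = 1 -> 0 < m -> win [:: 2; a] (c :: ones m.-1) /\ win [:: a] [:: 2, c & ones m.-1]) ->
  safe [:: a; b] (c :: ones m).
Proof.
move=> h1 h2 h3 h4 h5 h6 h7; apply: safeI.
- by apply: (merge2 (k := 0) (W := fun r => win r _)) => // r r' h; apply: win_perm.
- by apply: (merge1 (W := fun r => win _ r)) => // r r' h; apply: win_perm.
move=> x r s /(@pick2 a b 0)[[-> hr]|[-> hr]|[_ //]] /pick1[[e hb]|[e m0 hb]].
- by case: (h4 e) => w1 w2; split; [apply: win_perm w1|apply: win_perm w2]; rewrite ?perm_cons.
- by subst a; case: (h6 erefl m0) => w1 w2; split; [apply: win_perm w1|apply: win_perm w2]; rewrite ?perm_cons.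
- by case: (h5 e) => w1 w2; split; [apply: win_perm w1|apply: win_perm w2]; rewrite ?perm_cons.
by subst b; case: (h7 erefl m0) => w1 w2; split; [apply: win_perm w1|apply: win_perm w2]; rewrite ?perm_cons.
Qed.

Lemma safe22 a b c d m :
  win [:: a + b] [:: c, d & ones m] ->
  (1 < m -> win [:: a; b] [:: 2, c, d & ones m.-2]) ->
  (0 < m -> win [:: a; b] [:: c + 1, d & ones m.-1]) ->
  (0 < m -> win [:: a; b] [:: d + 1, c & ones m.-1]) ->
  win [:: a; b] (c + d :: ones m) ->
  (a = c -> win [:: a + a; b] (d :: ones m) /\ win [:: b] [:: a + a, d & ones m]) ->
  (a = d -> win [:: a + a; b] (c :: ones m) /\ win [:: b] [:: a + a, c & ones m]) ->
  (b = c -> win [:: b + b; a] (d :: ones m) /\ win [:: a] [:: b + b, d & ones m]) ->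
  (b = d -> win [:: b + b; a] (c :: ones m) /\ win [:: a] [:: b + b, c & ones m]) ->
  (a = 1 -> 0 < m -> win [:: 2; b] [:: c, d & ones m.-1] /\ win [:: b] [:: 2, c, d & ones m.-1]) ->
  (b = 1 -> 0 < m -> win [:: 2; a] [:: c, d & ones m.-1] /\ win [:: a] [:: 2, c, d & ones m.-1]) ->
  safe [:: a; b] [:: c, d & ones m].
Proof.
move=> h1 h2 h3 h4 h5 h6 h7 h8 h9 h10 h11; apply: safeI.
- by apply: (merge2 (k := 0) (W := fun r => win r _)) => // r r' h; apply: win_perm.
- by apply: (merge2 (W := fun r => win _ r)) => // r r' h; apply: win_perm.
move=> x r s /(@pick2 a b 0)[[-> hr]|[-> hr]|[_ //]] /pick2[[e hb]|[e hb]|[e m0 hb]].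
- by case: (h6 e) => w1 w2; split; [apply: win_perm w1|apply: win_perm w2]; rewrite ?perm_cons.
- by case: (h7 e) => w1 w2; split; [apply: win_perm w1|apply: win_perm w2]; rewrite ?perm_cons.
- by subst a; case: (h10 erefl m0) => w1 w2; split; [apply: win_perm w1|apply: win_perm w2]; rewrite ?perm_cons.
- by case: (h8 e) => w1 w2; split; [apply: win_perm w1|apply: win_perm w2]; rewrite ?perm_cons.
- by case: (h9 e) => w1 w2; split; [apply: win_perm w1|apply: win_perm w2]; rewrite ?perm_cons.
by subst b; case: (h11 erefl m0) => w1 w2; split; [apply: win_perm w1|apply: win_perm w2]; rewrite ?perm_cons.
Qed.

(** * One color reduced to a single stack *)

Lemma perm_two (x y : nat) s : x \in s -> y \in rem x s ->
  perm_eq s [:: x, y & rem y (rem x s)].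
Proof.
by move=> hx hy; rewrite (perm_trans (perm_to_rem hx)) // perm_cons perm_to_rem.
Qed.

Lemma win_single_merge d xs x y r : 0 < d -> all (leq 1) xs ->
  ~~ odd (size xs) -> d != sumn xs -> perm_eq xs [:: x, y & r] ->
  x + y != d -> d \notin r ->
  has (fun e => d < 2 * e) (x + y :: r) ||
    (count (fun e => 2 * e == d) (x + y :: r) <= 2) -> win [:: d] xs.
Proof.
move=> d0 pos ev ds h xy dr hn; apply: (win_r h); apply: goodI.
have hs := perm_size h; have hsum := perm_sumn h; have hp := perm_all (leq 1) h.
rewrite pos /= in hp; rewrite /= in hs hsum.
case/esym/and3P: hp => x0 y0 hp.
constructor => //=.
- by rewrite hp andbT; lia.
- by rewrite hs /= negbK in ev.
- by rewrite inE negb_or eq_sym xy dr.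
- by rewrite -addnA -hsum.
by move: hn; rewrite /= => /orP[-> //|->]; rewrite orbT.
Qed.

(** The splitter must merge so that no [d] remains: two copies of [d] are merged together, a single
    copy is merged with any other stack. If [d] is absent, the aim is a stack taller than [d / 2],
    or at most two of height exactly [d / 2]. *)
Lemma win_single d xs : 0 < d -> all (leq 1) xs -> ~~ odd (size xs) ->
  1 < size xs -> d != sumn xs -> count_mem d xs <= 2 ->
  (size xs = 2 \/ has (fun e => 2 * e != d) xs) -> win [:: d] xs.
Proof.
move=> d0 pos ev sz ds cd.
have two : exists (x y : nat) (r : seq nat), perm_eq xs [:: x, y & r].
  case: (xs) sz => [//|x [//|y r]] _; by exists x, y, r.
case: (ltnP 2 (size xs)) => sz3; last first.
  have [x [y [r h]]] := two.
  have hs := perm_size h; have hsum := perm_sumn h.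
  case: r h hs hsum => [|z r] h /= hs hsum; last by lia.
  by move=> _; apply: (win_single_merge (x := x) (y := y) (r := [::])) => //=; lia.
case; first by lia.
move=> hh.
case: (boolP (d \in xs)) => dxs.
  have: 0 < size (rem d xs) by rewrite size_rem // -subn1 subn_gt0 ltnW.
  have hd := perm_to_rem dxs.
  have cr : count_mem d (rem d xs) <= 1.
    by move: cd; rewrite (permP hd) /= eqxx add1n.
  case: (boolP (d \in rem d xs)) => d2.
    move=> _; apply: (win_single_merge d0 pos ev ds (perm_two dxs d2)) => //.
    - by lia.
    - apply/negP => d3.
      by move: cr; rewrite (permP (perm_to_rem d2)) /= (permP (perm_to_rem d3)) /= eqxx.
    by apply/orP; left => /=; lia.
  case e: (rem d xs) => [//|y r] _.
  have h : perm_eq xs [:: d, y & r] by rewrite -e.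
  have y0 : 0 < y by move: (perm_all (leq 1) h); rewrite pos /=; lia.
  apply: (win_single_merge (x := d) (y := y) (r := r)) => //; [lia| |apply/orP; left => /=; lia].
  by move: d2; rewrite e inE negb_or => /andP[].
have nd (r : seq nat) (x y : nat) : perm_eq xs [:: x, y & r] -> d \notin r.
  move=> h; apply: contra dxs => dr; rewrite (perm_mem h) !inE dr !orbT //.
case: (boolP (has (fun e => d < 2 * e) xs)) => hb.
  case/hasP: hb => e exs big.
  have he := perm_to_rem exs.
  case: (boolP (has (fun y => e + y != d) (rem e xs))) => hy.
    case/hasP: hy => y yin hy; have h := perm_two exs yin.
    by apply: (win_single_merge d0 pos ev ds h) => //; [exact: nd h|apply/orP; left => /=; lia].
  (* Every other stack completes [e] to [d], hence is shorter than [d / 2]. Merging two of them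
     stays below [d] and keeps the tall [e]. *)
  have := perm_size he; case er: (rem e xs) => [|x [|y r]] /= se; try lia.
  have h : perm_eq xs [:: x, y & e :: r].
    by rewrite (perm_trans he) // er (perm_catCA [:: e] [:: x; y] r).
  have: ~~ has (fun y => e + y != d) [:: x, y & r] by rewrite -er.
  rewrite /= !negb_or !negbK => /and3P[h1 h2 _].
  apply: (win_single_merge d0 pos ev ds h) => //; [lia|exact: nd h|].
  by apply/orP; left => /=; lia.
have small e : e \in xs -> 2 * e <= d.
  by move=> ein; rewrite leqNgt; apply: contra hb => lt; apply/hasP; exists e.
case/hasP: hh => y yin yd.
have y1 := small _ yin.
(* Without tall stacks, a half of [d] and the shorter [y] merge to a height strictly between [d / 2]
   and [d]. *)
case: (boolP (has (fun x => 2 * x == d) xs)) => hx.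
  case/hasP: hx => x xin xd.
  have xin2 : x \in rem y xs.
    have := xin; rewrite (perm_mem (perm_to_rem yin)) inE => /orP[/eqP xy|//].
    by rewrite -xy xd in yd.
  have h := perm_two yin xin2.
  have y0 : 0 < y by move/allP: pos; apply.
  by apply: (win_single_merge d0 pos ev ds h) => //; [lia|exact: nd h|apply/orP; left => /=; lia].
(* All heights are below [d / 2], so any merge stays below [d] and creates at most one half of
   [d]. *)
have [x [z [r h]]] := two.
have xin : x \in xs by rewrite (perm_mem h) mem_head.
have zin : z \in xs by rewrite (perm_mem h) !inE eqxx orbT.
have lt e : e \in xs -> 2 * e < d.
  move=> ein; have := small _ ein; rewrite leq_eqVlt => /orP[he|//].
  by case/negP: hx; apply/hasP; exists e.
have := lt _ xin; have := lt _ zin => l1 l2.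
apply: (win_single_merge d0 pos ev ds h) => //; [lia|exact: nd h|].
apply/orP; right => /=.
have: count (fun e => 2 * e == d) xs = 0 by apply/eqP; rewrite eqn0Ngt -has_count.
by rewrite (permP h) /=; lia.
Qed.

(** No capture is possible because [d] is absent from [xs], and a merge creates at most one [d],
    which [win_single] can remove. *)
Lemma safe_single d xs : 0 < d -> all (leq 1) xs -> odd (size xs) ->
  d \notin xs -> d != sumn xs ->
  [|| has (fun e => d < 2 * e) xs, count (fun e => 2 * e == d) xs <= 2
    | all (fun e => 2 * e == d) xs] -> safe [:: d] xs.
Proof.
move=> d0 pos od dxs ds nb; apply: safeI.
- by move=> x y r /perm_size.
- move=> x y r h.
  have hs := perm_size h; have hsum := perm_sumn h; have hp := perm_all (leq 1) h.
  rewrite pos /= in hp; rewrite /= in hs hsum.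
  case/esym/and3P: hp => x0 y0 hp.
  have nr : count_mem d r = 0.
    apply/count_memPn; apply: contra dxs => dr.
    by rewrite (perm_mem h) !inE dr !orbT.
  apply: win_single => //=.
  - by rewrite hp andbT; lia.
  - by rewrite hs /= negbK in od; rewrite od.
  - by rewrite hs /= in od; case: (r) od.
  - by rewrite -addnA -hsum.
  - by rewrite nr addn0; apply: leq_trans (leq_b1 _) _.
  move: nb; rewrite (perm_has _ h) (permP h) (perm_all _ h) /=.
  case/or3P => [/or3P[hx|hy|hr]|hc|/and3P[hx hy _]]; first by right; lia.
  - by right; lia.
  - right; apply/orP; right; apply: sub_has hr => e; lia.
  (* If [r] consists of halves of [d], it has at most two entries; its size is odd, hence 1, and two
     stacks remain in this color. *)
  - case: (boolP (has (fun e => 2 * e != d) r)) => hr; first by right; rewrite orbT.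
    have : count (fun e => 2 * e == d) r = size r.
      apply/eqP; rewrite -all_count -[all _ _]negbK -has_predC; exact: hr.
    move=> cr; move: hc; rewrite cr => hc.
    by rewrite hs /= in od; move: (size r) od hc => n *; left; lia.
  by right; lia.
move=> x r b h1 h2; have: x \in [:: d] by rewrite (perm_mem h1) mem_head.
by rewrite inE => /eqP e; case/negP: dxs; rewrite -e (perm_mem h2) mem_head.
Qed.

(** * The exceptional families, with two stacks in one color *)

Ltac arith := rewrite ?(inE, mem_nseq) /= ?(size_nseq, sumn_nseq, all_nseq, has_nseq,
    count_nseq, mul1n, muln1, negb_or) /=;
  repeat match goal with |- context [nat_of_bool ?b * _] =>
    let h := fresh "h" in case h: b; rewrite ?mul1n ?mul0n /= end;
  lia.
Ltac single := apply: win_single; arith.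
Ltac mergel x y r := apply: (@win_l x y r); [perms|].
Ltac merger x y r := apply: (@win_r x y r); [perms|].
Ltac lone := apply: goodI; apply: good_single; arith.
Ltac lonel x y := mergel x y (@nil nat); lone.
Ltac loner x y r := merger x y r; lone.

(** The color totals are [G + 2] and [G + 4], so uniting the left pair gives a lone stack different
    from the other total. Letting [H] absorb two ones stays in the family. *)
Lemma safe_Z1 G H b : 0 < G -> 0 < H -> ~~ odd b -> G + 2 = H + b ->
  10 <= G + H + 4 + b -> safe [:: G; 2] [:: H, 2 & ones b].
Proof.
move=> G0 H0 ob e n10; have G2 : 2 <= G by lia.
apply: safe22.
- single.
- move=> b1; merger H 2 (2 :: ones b.-2); apply: goodI; apply: good_Z1; lia.
- move=> b0; lonel G 2.
- move=> b0; lonel G 2.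
- case: (posnP b) => b0; first by subst b; lonel G 2.
  merger 1 1 (H + 2 :: ones b.-2).
  apply: (good_perm (B0 := [:: H + 2, 2 & ones b.-2])) (perm_refl _) _ _; first perms.
  by apply: goodI; apply: good_Z1; lia.
- move=> ?; subst H; split; first by lonel (G + G) 2.
  by loner 2 1 (G + G :: ones b.-1).
- move=> ?; subst G; split; first by lonel 4 2.
  by loner H 4 (ones b).
- move=> ?; subst H; split; first by lonel 4 G.
  case: (eqVneq G 4) => ?; first by subst G; loner 2 4 (ones b).
  by loner 2 1 (4 :: ones b.-1).
- move=> _; split; first by lonel 4 G.
  case: (eqVneq (H + 4) G) => ?; last by loner H 4 (ones b).
  by loner H 1 (4 :: ones b.-1).
- lia.
by lia.
Qed.

(** The totals again differ by 2. When the left 1 captures and becomes a 2, the splitter lets it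
    capture the right 2 and reaches [good_Z4]. *)
Lemma safe_Z1' G H b : 0 < G -> 0 < H -> ~~ odd b -> G + 1 = H + b ->
  10 <= G + H + 3 + b -> safe [:: G; 1] [:: H, 2 & ones b].
Proof.
move=> G0 H0 ob e n10; have G3 : 3 <= G by lia.
apply: safe22.
- single.
- move=> b1; merger H 2 (2 :: ones b.-2); apply: goodI; apply: good_Z1'; lia.
- move=> b0; lonel G 1.
- move=> b0; lonel G 1.
- case: (posnP b) => b0; first by subst b; lonel G 1.
  merger 1 1 (H + 2 :: ones b.-2).
  apply: (good_perm (B0 := [:: H + 2, 2 & ones b.-2])) (perm_refl _) _ _; first perms.
  by apply: goodI; apply: good_Z1'; lia.
- lia.
- lia.
- move=> ?; subst H; split; last single.
  apply: (@win_xl 2 [:: G] (1 :: ones b.-1)); [perms|perms|].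
  apply: (good_perm (R0 := [:: G; 4])) _ (perm_refl _) _; first perms.
  by apply: goodI; apply: good_Z4; lia.
- lia.
- lia.
move=> _ b0; split; last single.
apply: (@win_xl 2 [:: G] (H :: ones b.-1)); [perms|perms|].
apply: (good_perm (R0 := [:: G; 4])) _ (perm_refl _) _; first perms.
by apply: goodI; apply: good_Z4; lia.
Qed.

(** No capture is possible, and uniting the left pair gives [G + 2], still below the right giant. *)
Lemma safe_Z2 G H b : 1 < G -> H = G + 3 -> odd b ->
  safe [:: G; 2] (H :: ones b).
Proof.
move=> G0 -> ob; apply: safe21; try lia.
- single.
- move=> b1; lonel G 2.
by move=> b0; lonel G 2.
Qed.

(** Uniting the left pair into a 3 fails only if 3 occurs on the right. The last hypothesis excludes
    [H = 5], [b = 0], where crossing the 2s would lead to 4 and 1 against 5, lost for the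
    splitter. *)
Lemma safe_Z3 H b : odd H -> ~~ odd b -> 8 <= 5 + H + b ->
  H = 1 \/ ~~ odd ((5 + H + b)./2) -> safe [:: 2; 1] [:: H, 2 & ones b].
Proof.
move=> oH ob n8 hH; apply: safe22; try lia.
- single.
- move=> b1; case: (eqVneq H 3) => H3; last by lonel 2 1.
  subst H; merger 3 2 (2 :: ones b.-2); apply: goodI; apply: good_Z3; lia.
- move=> b0; lonel 2 1.
- move=> b0; case: (eqVneq H 3) => H3.
    subst H; merger 3 3 (ones b.-1); apply: goodI; apply: good_Z7; lia.
  (* The new 3 grows to 4, giving [good_Z5]. For [H = 1] and [b = 2] there are too few chips for
     [good_Z5], and the two right ones are merged instead. *)
  case: (eqVneq b 2) => b2.
    case: (eqVneq H 1) => H1.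
      subst H b; merger 1 1 [:: 3].
      apply: (good_perm (B0 := [:: 3, 2 & ones 0])) (perm_refl _) _ _; first perms.
      by apply: goodI; apply: (@good_Z3 3 0) => //; right.
    subst b; merger 3 1 [:: H].
    apply: (good_perm (B0 := [:: H, 4 & ones 0])) (perm_refl _) _ _; first perms.
    by apply: goodI; apply: good_Z5; lia.
  merger 3 1 (H :: ones b.-2).
  apply: (good_perm (B0 := [:: H, 4 & ones b.-2])) (perm_refl _) _ _; first perms.
  by apply: goodI; apply: good_Z5; lia.
- case: (posnP b) => b0; first by subst b; apply: win_sym; single.
  (* If half the total is odd, the hypothesis forces [H = 1], and giants 2 and 4 have the right
     parity. Otherwise [H + 2] stays in the family. *)
  case: (boolP (odd ((5 + H + b)./2))) => o4.
    have ? : H = 1 by lia.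
    subst H; merger 3 1 (ones b.-1); apply: goodI.
    by apply: (@good_even_giants 2 1 4 b.-1); [constructor|..]; lia.
  merger 1 1 (H + 2 :: ones b.-2).
  apply: (good_perm (B0 := [:: H + 2, 2 & ones b.-2])) (perm_refl _) _ _; first perms.
  by apply: goodI; apply: good_Z3; lia.
- move=> _; split.
    (* Uniting 4 and 1 fails when 5 is a right height or the right total. Then [b] is positive, and
       a right one captures the left 1. *)
    case: (boolP ((H == 5) || (H + b == 5))) => hh; last by lonel 4 1.
    by apply: (@win_xr 1 [:: 4] (H :: ones b.-1)); [perms|perms|lone].
  case: (posnP b) => b0; first by subst b; single.
  by apply: (@win_xl 1 [::] [:: 4, H & ones b.-1]); [perms|perms|lone].
- move=> ?; subst H; split; last by loner 2 2 (ones b).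
  by apply: (@win_xr 2 [:: 2] (ones b)); [perms|perms|lone].
move=> _ b0; split; last by loner 2 2 (H :: ones b.-1).
by apply: (@win_xr 2 [:: 2] (H :: ones b.-1)); [perms|perms|lone].
Qed.

Lemma safe_Z4 G H b : 0 < H -> odd b -> G = H + b ->
  safe [:: G; 4] (H :: ones b).
Proof.
move=> H0 ob e; apply: safe21; try lia.
- single.
- move=> b1; lonel G 4.
- move=> b0; lonel G 4.
move=> ?; subst H; split; first by lonel 8 G.
case: (eqVneq b 5) => b5; last by loner 8 1 (ones b.-1).
by subst b; loner 1 1 (8 :: ones 3).
Qed.

(** No merge on the right creates a 3, so uniting the left pair answers all of them. *)
Lemma safe_Z5 H b : odd H -> H <> 3 -> ~~ odd b -> 8 < 7 + H + b ->
  safe [:: 2; 1] [:: H, 4 & ones b].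
Proof.
move=> oH H3 ob n8; apply: safe22; try lia.
- single.
- move=> b1; lonel 2 1.
- move=> b0; lonel 2 1.
- move=> b0; lonel 2 1.
- lonel 2 1.
- move=> ?; subst H; split; last by loner 4 2 (ones b).
  (* With [H = 1] the strict bound on the total gives [0 < b]. *)
  merger 4 1 (ones b.-1); apply: goodI; apply: good_Z2; lia.
move=> _ b0; split; last by loner H 2 (4 :: ones b.-1).
merger H 4 (ones b.-1); apply: goodI; apply: good_Z6; lia.
Qed.

Lemma safe_Z6 H b : 5 <= H -> odd b -> safe [:: 2; 2] (H :: ones b).
Proof.
move=> H5 ob; apply: safe21; try lia.
- single.
- move=> b1; lonel 2 2.
by move=> b0; lonel 2 2.
Qed.

Lemma safe_Z7 b : odd b -> safe [:: 2; 1] (6 :: ones b).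
Proof.
move=> ob; apply: safe21; try lia.
- single.
- move=> b1; lonel 2 1.
- move=> b0; lonel 2 1.
move=> _ b0; split; first by lonel 2 2.
by loner 6 2 (ones b.-1).
Qed.

Lemma safe_33 : safe [:: 2; 2] [:: 1; 1].
Proof.
apply: (@safe21 2 2 1 1); try lia; first single.
by move=> _; apply: win_sym; single.
Qed.

(** * Positions with one giant in each color *)

Lemma odd_giants_sym G k H m : odd_giants G k H m -> odd_giants H m G k.
Proof. by case=> *; constructor; lia. Qed.

Lemma even_giants_sym G k H m : even_giants G k H m -> even_giants H m G k.
Proof. by case=> *; constructor; lia. Qed.

(** If [k = 0], [G = 2] and [H = 1], all right stacks are halves of [G]; this calls for the last
    alternative of [good_single]. *)
Lemma good_of_odd_giants G k H m : odd_giants G k H m ->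
  good (G :: ones k) (H :: ones m).
Proof.
move=> h; case: (posnP k) => k0; first by case: h => *; subst k; lone.
case: (posnP m) => m0; last by apply: goodI; apply: good_odd_giants.
by case: h => *; subst m; apply: goodS; apply: good_single; arith.
Qed.

(** For [k = 0] the last two conditions of [even_giants] separate [G] from the other giant and from
    the other total. *)
Lemma good_of_even_giants G k H m : even_giants G k H m ->
  good (G :: ones k) (H :: ones m).
Proof.
move=> h; case: (posnP k) => k0; first by case: h => *; subst k; lone.
case: (posnP m) => m0; last by apply: goodI; apply: good_even_giants.
by case: h => *; subst m; apply: goodS; apply: good_single; arith.
Qed.

Ltac oddg := apply: good_of_odd_giants; constructor; lia.
Ltac eveng := apply: good_of_even_giants; constructor; lia.

Lemma odd_giants_merge_ones G k H m : odd_giants G k H m -> 0 < m -> 1 < k ->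
  win [:: 2, G & ones k.-2] (H :: ones m).
Proof. by case=> *; mergel G 2 (ones k.-2); oddg. Qed.

Lemma odd_giants_merge_one G k H m : odd_giants G k H m -> 0 < m -> 0 < k ->
  win (G + 1 :: ones k.-1) (H :: ones m).
Proof.
case=> *; case: (eqVneq k 1) => k1; first by subst k; single.
by mergel (G + 1) 1 (ones k.-2); rewrite -addnA; oddg.
Qed.

Lemma odd_giants_cross_ones G k H m : odd_giants G k H m -> 0 < m -> 0 < k ->
  win [:: 2, G & ones k.-1] (H :: ones m.-1).
Proof.
case=> *; case: (eqVneq m 1) => m1; first by subst m; apply: win_sym; single.
by mergel G 2 (ones k.-1); oddg.
Qed.

(** By default [G] absorbs the new 2. This fails if [k = 3] and the totals agree, which leaves too
    few ones, or if [k = 2] and [H = G + 2], which leaves a lone giant equal to the other one. *)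
Lemma even_giants_merge_ones G k H m : even_giants G k H m -> 0 < m -> 1 < k ->
  win [:: 2, G & ones k.-2] (H :: ones m).
Proof.
case=> G0 H0 okm mod4 n10 hG hH hGH hst m0 k1.
case: (eqVneq k 3) => k3; first case: (eqVneq (G + k) (H + m)) => est.
- subst k; apply: (@win_xr 1 [:: 2; G] (H :: ones m.-1)); [perms|perms|].
  apply: (good_perm (R0 := [:: G; 2]) (B0 := [:: H, 2 & ones m.-1])); [perms|perms|].
  by apply: goodI; apply: good_Z1; lia.
- by mergel G 2 (ones k.-2); eveng.
case: (eqVneq k 2) => k2; first case: (eqVneq H (G + 2)) => eH.
- subst k H; case: (eqVneq G 1) => G1.
    subst G; merger 1 1 (3 :: ones m.-2).
    apply: (good_perm (B0 := [:: 3, 2 & ones m.-2])) (perm_refl _) _ _; first perms.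
    by apply: goodI; apply: good_Z3; lia.
  merger (G + 2) 1 (ones m.-1).
  apply: (good_perm (R0 := [:: G; 2])) _ (perm_refl _) _; first perms.
  by apply: goodI; apply: good_Z2; lia.
- by mergel G 2 (ones k.-2); eveng.
by mergel G 2 (ones k.-2); eveng.
Qed.

(** The obstructions to growing the giant by 2 are those of [even_giants_merge_ones]. For [k = 1]
    the color becomes a single stack, and the totals differ because equal totals require three ones
    on each side. *)
Lemma even_giants_merge_one G k H m : even_giants G k H m -> 0 < m -> 0 < k ->
  win (G + 1 :: ones k.-1) (H :: ones m).
Proof.
case=> G0 H0 okm mod4 n10 hG hH hGH hst m0 k0.
case: (eqVneq k 1) => k1; first by subst k; single.
case: (eqVneq k 3) => k3; first case: (eqVneq (G + k) (H + m)) => est.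
- subst k; apply: (@win_xr 1 [:: G + 1; 1] (H :: ones m.-1)); [perms|perms|].
  apply: (good_perm (B0 := [:: H, 2 & ones m.-1])) (perm_refl _) _ _; first perms.
  by apply: goodI; apply: good_Z1'; lia.
- by mergel (G + 1) 1 (ones k.-2); rewrite -addnA; eveng.
case: (eqVneq k 2) => k2; first case: (eqVneq H (G + 2)) => eH.
- subst k H; case: (eqVneq G 1) => G1.
    subst G; merger 1 1 (3 :: ones m.-2).
    apply: (good_perm (B0 := [:: 3, 2 & ones m.-2])) (perm_refl _) _ _; first perms.
    by apply: goodI; apply: good_Z3; lia.
  by apply: (@win_xr 1 [:: G + 1] (G + 2 :: ones m.-1)); [perms|perms|lone].
- by mergel (G + 1) 1 (ones k.-2); rewrite -addnA; eveng.
by mergel (G + 1) 1 (ones k.-2); rewrite -addnA; eveng.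
Qed.

(** The capture moves one chip to the left, so the totals are now equal exactly when
    [G + k + 2 = H + m]; this is harmful only if few ones remain. Another obstruction to the default
    [G + 2] is [k = 1], [H = G + 2]. *)
Lemma even_giants_cross_ones G k H m : even_giants G k H m -> 0 < m -> 0 < k ->
  win [:: 2, G & ones k.-1] (H :: ones m.-1).
Proof.
case=> G0 H0 okm mod4 n10 hG hH hGH hst m0 k0.
case: (eqVneq m 1) => m1; first by subst m; apply: win_sym; single.
case: (eqVneq m 2) => m2; first case: (eqVneq H 1) => H1.
(* Only two ones are left on the right, which [even_giants] excludes; one of them captures a left
   one. *)
- subst H m; apply: (@win_xr 1 [:: 2, G & ones k.-2] [:: 1]); [perms|perms|].
  apply: good_sym.
  apply: (good_perm (B0 := [:: G, 2 & ones k.-2])) (perm_refl _) _ _; first perms.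
  by apply: goodI; apply: good_Z3; lia.
- case: (eqVneq (G + k + 2) (H + m)) => est; last by mergel G 2 (ones k.-1); eveng.
  subst m; apply: (@win_xl 1 [:: 2, G & ones k.-2] [:: H]); [perms|perms|].
  by apply: goodS; apply: good_single; arith.
case: (eqVneq (G + k + 2) (H + m)) => est.
  case: (eqVneq k 2) => k2; last by mergel G 2 (ones k.-1); eveng.
  subst k; apply: (@win_xr 1 [:: 2; G] (H :: ones m.-2)); [perms|perms|].
  apply: (good_perm (R0 := [:: G; 2]) (B0 := [:: H, 2 & ones m.-2])); [perms|perms|].
  by apply: goodI; apply: good_Z1; lia.
case: (eqVneq k 1) => k1; last by mergel G 2 (ones k.-1); eveng.
case: (eqVneq H (G + 2)) => eH; last by mergel G 2 (ones k.-1); eveng.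
subst k H; merger (G + 2) 1 (ones m.-2).
apply: (good_perm (R0 := [:: G; 2])) _ (perm_refl _) _; first perms.
by apply: goodI; apply: good_Z2; lia.
Qed.

(** The right color lost its giant and needs a new one of the parity of [G]: a one if [G] is odd,
    while the left giant grows to [2 * G + 1]; a merged pair of ones if [G] is even. The shapes
    treated apart would get equal totals with too few ones. *)
Lemma even_giants_cross G k m : even_giants G k G m -> 0 < m -> 0 < k -> 1 < G ->
  win (G + G :: ones k) (ones m).
Proof.
case=> G0 H0 okm mod4 n10 hG hH hGH hst m0 k0 G2.
case: (eqVneq m 1) => m1.
  subst m; apply: (@win_xr 1 (G + G :: ones k.-1) [::]); [perms|perms|].
  by apply: goodS; apply: good_single; arith.
case: (eqVneq m 2) => m2.
  by subst m; merger 1 1 (@nil nat); apply: goodS; apply: good_single; arith.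
case: (boolP (odd G)) => oG.
  have [km|km] : k = 2 /\ m = G + G + 2 \/ (k <> 2 \/ m <> G + G + 2) by lia.
    case: km => ? em; subst k.
    apply: (@win_xr 1 [:: G + G; 1] (ones m.-1)); [perms|perms|].
    apply: (good_perm (B0 := [:: 1, 2 & ones m.-2])) (perm_refl _) _ _; first perms.
    by apply: goodI; apply: good_Z1'; lia.
  mergel (G + G) 1 (ones k.-1).
  apply: (good_perm (B0 := 1 :: ones m.-1)) (perm_refl _) _ _; first perms.
  by eveng.
have [km|km] : k = 1 /\ m = G + G + 1 \/ (k <> 1 \/ m <> G + G + 1) by lia.
  case: km => ? em; subst k.
  by apply: (@win_xr 1 [:: G + G] (ones m.-1)); [perms|perms|lone].
by merger 1 1 (ones m.-2); eveng.
Qed.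

Lemma safe_odd_giants G k H m : odd_giants G k H m -> 0 < k -> 0 < m ->
  safe (G :: ones k) (H :: ones m).
Proof.
move=> h k0 m0; have h' := odd_giants_sym h.
apply: safe11 => //.
- exact: odd_giants_merge_ones.
- exact: odd_giants_merge_one.
- by move=> m1; apply: win_sym; apply: odd_giants_merge_ones.
- by move=> m1; apply: win_sym; apply: odd_giants_merge_one.
- by move=> e; subst H; case: h => _ _; rewrite addnn odd_double.
by split; [|apply: win_sym]; exact: odd_giants_cross_ones.
Qed.

Lemma safe_even_giants G k H m : even_giants G k H m -> 0 < k -> 0 < m ->
  safe (G :: ones k) (H :: ones m).
Proof.
move=> h k0 m0; have h' := even_giants_sym h.
have x1 := even_giants_cross_ones h m0 k0.
have x2 := win_sym (even_giants_cross_ones h' k0 m0).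
apply: safe11 => //.
- exact: even_giants_merge_ones.
- exact: even_giants_merge_one.
- by move=> m1; apply: win_sym; apply: even_giants_merge_ones.
- by move=> m1; apply: win_sym; apply: even_giants_merge_one.
move=> ?; subst H; case: (eqVneq G 1) => G1.
  (* Crossing giants of height 1 is crossing two ones. *)
  subst G; split; [apply: win_perm x1|apply: win_perm x2]; perms.
have G2 : 1 < G by case: h; lia.
by split; [exact: even_giants_cross|apply: win_sym; exact: even_giants_cross].
Qed.

Lemma good_safe R B : good R B -> safe R B.
Proof.
have h R0 B0 : good0 R0 B0 -> safe R0 B0.
  case.
  - exact: safe_single.
  - exact: safe_odd_giants.
  - exact: safe_even_giants.
  - exact: safe_Z1.
  - exact: safe_Z1'.
  - exact: safe_Z2.
  - exact: safe_Z3.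
  - exact: safe_Z4.
  - exact: safe_Z5.
  - exact: safe_Z6.
  - exact: safe_Z7.
  exact: safe_33.
by case=> R0 [B0 [hR hB [/h|/h/safe_sym]]]; apply: safe_perm.
Qed.

(** * The starting position with an even total *)

Lemma safe_onesI p q :
  win (2 :: ones p.-2) (ones q) -> win (ones p) (2 :: ones q.-2) ->
  win (2 :: ones p.-1) (ones q.-1) -> win (ones p.-1) (2 :: ones q.-1) ->
  safe (ones p) (ones q).
Proof.
move=> w1 w2 w3 w4; apply: safeI.
- move=> x y r /pick0[-> _]; rewrite perm_sym => /pick0[-> _ hr].
  by apply: win_perm w1; rewrite ?perm_cons.
- move=> x y r /pick0[-> _]; rewrite perm_sym => /pick0[-> _ hr].
  by apply: win_perm w2; rewrite ?perm_cons.
move=> x r b /pick0[-> _ hr] /pick0[_ _ hb].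
by split; [apply: win_perm w3|apply: win_perm w4]; rewrite ?perm_cons.
Qed.

(** For [q > 3] the same position [T] answers all four opening moves. *)
Lemma safe_ones3 q : odd q -> 3 <= q -> safe (ones 3) (ones q).
Proof.
move=> oq q3; case: (eqVneq q 3) => [->|q3'].
  apply: safe_onesI.
  - apply: (@win_xl 1 [:: 2] (ones 2)); [perms|perms|exact: goodI good_33].
  - apply: (@win_xr 1 (ones 2) [:: 2]); [perms|perms|exact: goodS good_33].
  - by mergel 1 1 [:: 2]; exact: goodI good_33.
  by merger 1 1 [:: 2]; exact: goodS good_33.
have T : good [:: 2; 1] (2 :: ones q.-2).
  apply: (good_perm (B0 := [:: 1, 2 & ones (q - 3)])) (perm_refl _) _ _; first perms.
  by apply: goodI; apply: good_Z3; lia.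
apply: safe_onesI.
- by merger 1 1 (ones q.-2).
- by mergel 1 1 [:: 1].
- by apply: (@win_xr 1 [:: 2; 1] (ones q.-2)); [perms|perms|].
by apply: (@win_xl 1 [:: 1] (2 :: ones q.-2)); [perms|perms|].
Qed.

Lemma safe_ones44 : safe (ones 4) (ones 4).
Proof.
have T : good [:: 2; 1] (2 :: ones 3).
  apply: (good_perm (B0 := [:: 1, 2 & ones 2])) (perm_refl _) _ _; first perms.
  by apply: goodI; apply: good_Z3; lia.
have T' := good_sym T.
apply: safe_onesI.
- by apply: (@win_xr 1 [:: 2; 1] (ones 3)); [perms|perms|].
- by apply: (@win_xl 1 (ones 3) [:: 2; 1]); [perms|perms|].
- by merger 1 1 [:: 1].
by mergel 1 1 [:: 1].
Qed.

(** If 4 divides the total, giants of height 1 already have the required parity. Otherwise the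
    giants must be even, and the first two moves create a 2 in each color. *)
Lemma safe_ones p q : 3 <= p -> p <= q -> ~~ odd (p + q) ->
  safe (ones p) (ones q).
Proof.
move=> p3 pq ev.
case: (eqVneq p 3) => [?|p3']; first by subst p; apply: safe_ones3; lia.
case: (eqVneq q 4) => [?|q4].
  by have ? : p = 4 by [lia]; subst p q; exact: safe_ones44.
case: (eqVneq ((p + q) %% 4) 0) => m4.
  apply: (safe_perm (R0 := 1 :: ones p.-1) (B0 := 1 :: ones q.-1)); [perms|perms|].
  by apply: good_safe; eveng.
apply: safe_onesI.
- by merger 1 1 (ones q.-2); eveng.
- by mergel 1 1 (ones p.-2); eveng.
- by merger 1 1 (ones q.-1.-2); eveng.
by mergel 1 1 (ones p.-1.-2); eveng.
Qed.

(** * Sets of positions to which one player can always return *)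

Definition answered (g : seq nat -> seq nat -> Prop) :=
  forall R B R' B', g R B -> step R B R' B' ->
    exists R'' B'', step R' B' R'' B'' /\ g R'' B''.

(** The start is added because it need not be [good], for instance when half the total is odd. *)
Definition good_or_start p q R B :=
  good R B \/ perm_eq R (ones p) /\ perm_eq B (ones q).

Lemma good_answered : answered good.
Proof. by move=> R B R' B' /good_safe; apply. Qed.

Lemma good_or_start_answered p q : 3 <= p -> p <= q -> ~~ odd (p + q) ->
  answered (good_or_start p q).
Proof.
move=> p3 pq ev R B R' B' [/good_safe h|[hR hB]] hs.
  by case: (h _ _ hs) => R'' [B'' [h1 h2]]; exists R'', B''; split=> //; left.
have := safe_perm hR hB (safe_ones p3 pq ev) hs.
by case=> R'' [B'' [h1 h2]]; exists R'', B''; split=> //; left.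
Qed.

(* With one color only, the parity of the number of stacks decides; from the
   pair {2}|{1,...,1}, any merge creates a 2 that can be captured. *)
Definition merged R B := R = [::] /\ odd (size B) \/
  exists q, [/\ perm_eq R [:: 2], perm_eq B (ones q), 0 < q & ~~ odd q].

Definition merged_sym R B := merged R B \/ merged B R.

Lemma merged_step R B R' B' : merged R B -> step R B R' B' ->
  exists R'' B'', step R' B' R'' B'' /\ merged_sym R'' B''.
Proof.
case=> [[-> oB]|[q [hR hB q0 eq]]].
  case=> [x y r /perm_size //|x y b hB hB' hR'|x r b /perm_size //|x r b /perm_size //].
  move: oB; rewrite (perm_size hB) /= negbK.
  case: b hB hB' => [//|z b] _ hB' /= ob; exists [::], (x + y + z :: b); split.
    by apply: step_merge_r hB' (perm_refl _) _; rewrite perm_sym.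
  by left; left; split.
case=> [x y r|x y b h hB' hR'|x r b h1 h2|x r b h1 h2].
- by move/perm_size; rewrite (perm_size hR).
- have hr : perm_eq R' [:: 2] by rewrite (perm_trans hR').
  rewrite perm_sym in hB; have := perm_trans hB h.
  case/pick0 => ? _; rewrite perm_sym => /pick0[? q1 hb]; subst x y.
  exists [::], (2 + 2 :: ones q.-2); split; last by left; left; rewrite /= size_nseq; split=> //; lia.
  apply: (step_cross_r (x := 2) (r := [::]) (b := ones q.-2)) => //.
  by rewrite (perm_trans hB') // perm_cons.
- rewrite perm_sym in hB; case: (pick0 (perm_trans hB h2)) => ? _ _; subst x.
  by have := perm_mem h1 1; rewrite (perm_mem hR) !inE.
- rewrite perm_sym in hB; case: (pick0 (perm_trans hB h2)) => ? _ _; subst x.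
  by have := perm_mem h1 1; rewrite (perm_mem hR) !inE.
Qed.

Lemma merged_answered : answered merged_sym.
Proof.
move=> R B R' B' [h|h] hs; first exact: merged_step h hs.
case: (merged_step h (step_sym hs)) => R'' [B'' [h1 h2]].
by exists B'', R''; split; [exact: step_sym|apply/or_comm].
Qed.

(** * From stacks of chips to heights by color *)

Definition heights (c : color) (P : position) : seq nat :=
  [seq size s | s <- P & ohead s == Some c].

(** An empty stack has no top color and would be invisible to [heights]. *)
Definition nonempty (P : position) := all (fun s : stack => 0 < size s) P.

Lemma perm_heights c P Q : perm_eq P Q -> perm_eq (heights c P) (heights c Q).
Proof. by move=> h; apply: perm_map; apply: perm_filter. Qed.

Lemma heights_cons a e s P : heights a ((e :: s) :: P) =
  if e == a then (size s).+1 :: heights a P else heights a P.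
Proof. by rewrite /heights /= (inj_eq Some_inj); case: ifP. Qed.

Lemma color_cases (c d e : color) : c <> d -> e = c \/ e = d.
Proof. by case: c; case: d; case: e => //; auto. Qed.

Lemma legal_move_step c d P Q : c <> d -> nonempty P -> legal_move P Q ->
  nonempty Q /\ step (heights c P) (heights d P) (heights c Q) (heights d Q).
Proof.
move=> cd wP [s [t [R [hP hc hQ]]]].
move: wP; rewrite /nonempty (perm_all _ hP) (perm_all _ hQ) /= size_cat.
case/and3P=> s0 t0 wR; split; first by rewrite ltn_addr.
have := perm_heights d hQ; have := perm_heights c hQ.
have := perm_heights d hP; have := perm_heights c hP.
case: s s0 hc {hP hQ} => [//|a s] _; case: t t0 => [//|b t] _ hc.
rewrite cat_cons !heights_cons size_cat -addSn [size (b :: t)]/=.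
have ncd : (c == d) = false by apply/eqP.
have ndc : (d == c) = false by rewrite eq_sym.
rewrite /compatible /height /top_color /= in hc.
case: (color_cases a cd) hc => ->; case: (color_cases b cd) => -> hc;
  rewrite ?eqxx ?ncd ?ndc => p1 p2 p3 p4.
- by apply: step_merge_l p1 p3 _; rewrite (perm_trans p4) // perm_sym.
- case: hc => [e|[e]]; last by rewrite e in cd.
  by rewrite -e in p2 p3; exact: step_cross_l p1 p2 p3 p4.
- case: hc => [e|[e]]; last by rewrite e in cd.
  by rewrite -e in p1 p4; exact: step_cross_r p1 p2 p3 p4.
by apply: step_merge_r p2 p4 _; rewrite (perm_trans p3) // perm_sym.
Qed.

Lemma heights_pick c P x r : perm_eq (heights c P) (x :: r) ->
  exists s R, [/\ perm_eq P (s :: R), top_color s = Some c, height s = x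
                & perm_eq (heights c R) r].
Proof.
move=> h; have: x \in heights c P by rewrite (perm_mem h) mem_head.
case/mapP=> s; rewrite mem_filter => /andP[/eqP sc sP] xs.
exists s, (rem s P); split=> //; first exact: perm_to_rem.
rewrite -(perm_cons x) -(permPr h) perm_sym.
by rewrite (perm_trans (perm_heights c (perm_to_rem sP))) // /heights /= sc eqxx /= -xs.
Qed.

Lemma heights_top a e s P : top_color s = Some e ->
  heights a (s :: P) = if e == a then height s :: heights a P else heights a P.
Proof. by case: s => // e' s [->]; exact: heights_cons. Qed.

Lemma top_color_cat e s t : top_color s = Some e -> top_color (s ++ t) = Some e.
Proof. by case: s. Qed.

Lemma legal_moveI (P : position) s t R : perm_eq P [:: s, t & R] ->
  compatible s t -> legal_move P ((s ++ t) :: R).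
Proof. by move=> h hc; exists s, t, R. Qed.

Lemma step_legal_move c d P R' B' : c <> d ->
  step (heights c P) (heights d P) R' B' ->
  exists Q, [/\ legal_move P Q, perm_eq (heights c Q) R' & perm_eq (heights d Q) B'].
Proof.
move=> cd; have ncd : (c == d) = false by apply/eqP.
have ndc : (d == c) = false by rewrite eq_sym.
(* [merge] and [cross] take an arbitrary ordered pair of colors; each is applied in both orders. *)
have merge a b x y r A' D' : (a == b) = false -> perm_eq (heights a P) [:: x, y & r] ->
    perm_eq A' (x + y :: r) -> perm_eq D' (heights b P) ->
    exists Q, [/\ legal_move P Q, perm_eq (heights a Q) A' & perm_eq (heights b Q) D'].
  move=> nab /heights_pick[s [S [hs sa sx]]] /heights_pick[t [T [ht ta ty hT]]] hA hD.
  have hP : perm_eq P [:: s, t & T] by rewrite (perm_trans hs) // perm_cons.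
  exists ((s ++ t) :: T); split.
  - by apply: legal_moveI hP _; right; rewrite sa.
  - rewrite (heights_top _ _ (top_color_cat _ sa)) eqxx /height size_cat.
    by rewrite perm_sym (perm_trans hA) // -sx -ty perm_cons perm_sym.
  rewrite (heights_top _ _ (top_color_cat _ sa)) nab perm_sym (perm_trans hD) //.
  by rewrite (perm_trans (perm_heights b hP)) // (heights_top _ _ sa) (heights_top _ _ ta) nab.
have cross a b x r u A' D' : (a == b) = false -> (b == a) = false ->
    perm_eq (heights a P) (x :: r) ->
    perm_eq (heights b P) (x :: u) -> perm_eq A' (x + x :: r) -> perm_eq D' u ->
    exists Q, [/\ legal_move P Q, perm_eq (heights a Q) A' & perm_eq (heights b Q) D'].
  move=> nab nba /heights_pick[s [S [hs sa sx hS]]] hb hA hD.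
  have := perm_heights b hs; rewrite (heights_top _ _ sa) nab perm_sym => hbS.
  case/heights_pick: (perm_trans hbS hb) => t [T [ht tb ty hT]].
  have hP : perm_eq P [:: s, t & T] by rewrite (perm_trans hs) // perm_cons.
  have haS := perm_heights a ht; rewrite (heights_top _ _ tb) nba in haS.
  exists ((s ++ t) :: T); split.
  - by apply: legal_moveI hP _; left; rewrite sx ty.
  - rewrite (heights_top _ _ (top_color_cat _ sa)) eqxx perm_sym (perm_trans hA) //.
    have -> : height (s ++ t) = x + x by rewrite -{1}sx -ty; exact: size_cat.
    by rewrite perm_cons -(permPl hS).
  by rewrite (heights_top _ _ (top_color_cat _ sa)) nab perm_sym (perm_trans hD) // perm_sym.
case=> [x y r h1 h2 h3|x y b h1 h2 h3|x r b h1 h2 h3 h4|x r b h1 h2 h3 h4].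
- exact: merge ncd h1 h2 h3.
- by case: (merge _ _ _ _ _ _ _ ndc h1 h2 h3) => Q [q1 q2 q3]; exists Q.
- exact: cross ncd ndc h1 h2 h3 h4.
by case: (cross _ _ _ _ _ _ _ ndc ncd h2 h1 h4 h3) => Q [q1 q2 q3]; exists Q.
Qed.

(** * Winning strategies from kernels *)

Definition kernel (K : position -> Prop) :=
  forall P Q, K P -> legal_move P Q -> exists T, legal_move Q T /\ K T.

(** The winner answers every move by returning to [K]. Bob also needs a start with a legal move,
    since on a terminal start nobody has moved last. *)
Lemma kernel_winning (K : position -> Prop) w P0 : kernel K ->
  match w with
  | Alice => exists T, legal_move P0 T /\ K T
  | Bob => K P0 /\ ~ terminal P0
  end -> has_winning_strategy w P0.
Proof.
move=> hK h0.
have [sigma hsigma] : exists sigma : strategy, forall P h,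
    (exists T, legal_move P T /\ K T) ->
    legal_move P (sigma (P :: h)) /\ K (sigma (P :: h)).
  (* The default [[::]] is for the empty history, which no play produces. *)
  exists (fun h => if h is P :: _ then
    epsilon (inhabits [::]) (fun T => legal_move P T /\ K T) else [::]) => P h.
  exact: epsilon_spec.
exists sigma.
(* The position lies in [K] on the opponent's turns and has a move into [K] on the turns of [w]. *)
have inv H : follows w sigma P0 H -> forall P h, H = P :: h ->
    if mover (size h) is Alice then
      (if w is Alice then exists T, legal_move P T /\ K T else K P)
    else (if w is Bob then exists T, legal_move P T /\ K T else K P).
  elim=> {H} [P h [<- <-] /=|P Q h _ IH hPQ hs P' h' [<- <-] /=].
    by case: w h0 {hsigma} => // [[]].
  have := IH _ _ erefl; move: hs; rewrite /mover /=; case: (odd (size h)) => /=;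
    case: (w) => hs; try by move/hK => hk; exact: hk.
  - by case/(hsigma P h) => _; rewrite -hs.
  by case/(hsigma P h) => _; rewrite -hs.
move=> P h hf; have hi := inv _ hf _ _ erefl; split.
  move=> hw _; have: exists T, legal_move P T /\ K T.
    by move: hi hw; case: (mover _); case: (w).
  by case/(hsigma P h).
move=> tP; case: h hf hi => [|P' h] hf hi.
  have [eP] : [:: P] = [:: P0] by inversion hf.
  subst P; move: hi h0 => /=; case: (w) => [[T [/tP]]|_ [_ /(_ tP)]] //.
exists P, P', h; split=> //; move: hi; rewrite /mover /=.
by case: (odd _) => /=; case: (w) => // [[T [/tP]]].
Qed.

Lemma legal_move_size P Q : legal_move P Q -> size P = (size Q).+1.
Proof. by case=> s [t [R [/perm_size -> _ /perm_size ->]]]. Qed.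

(** Playing the two strategies against each other yields a play that follows both, whose last mover
    would be both players. The number of stacks bounds its length. *)
Lemma not_both_win P0 :
  has_winning_strategy Alice P0 -> has_winning_strategy Bob P0 -> False.
Proof.
move=> [sA hA] [sB hB].
suff H n : forall P h, size P <= n -> follows Alice sA P0 (P :: h) ->
    follows Bob sB P0 (P :: h) -> False.
  exact: H (leqnn _) (follows_start _ _ _) (follows_start _ _ _).
elim: n => [|n IH] P h sz fA fB; have [lA tA] := hA _ _ fA;
  have [lB tB] := hB _ _ fB;
  (case: (excluded_middle_informative (terminal P)) => tP;
    first by have [? [? [? [e eA]]]] := tA tP; have [? [? [? [e' eB]]]] := tB tP;
      move: eB; rewrite e in e'; case: e' => _ _ <-; rewrite eA).
- by case: tP => Q /legal_move_size; case: (size P) sz.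
case e: (mover (size h)).
  have hl := lA e tP; apply: (IH (sA (P :: h)) (P :: h)).
  - by move: sz; rewrite (legal_move_size hl).
  - exact: follows_move fA hl _.
  by apply: follows_move fB hl _; rewrite e.
have hl := lB e tP; apply: (IH (sB (P :: h)) (P :: h)).
- by move: sz; rewrite (legal_move_size hl).
- by apply: follows_move fA hl _; rewrite e.
exact: follows_move fB hl _.
Qed.

(** * Transfer to the game and conclusion *)

Definition lift (g : seq nat -> seq nat -> Prop) c d (P : position) :=
  nonempty P /\ exists R B, [/\ perm_eq (heights c P) R, perm_eq (heights d P) B & g R B].

Lemma kernel_lift g c d : c <> d -> answered g -> kernel (lift g c d).
Proof.
move=> cd hg P Q [wP [R [B [hR hB hgRB]]]] hPQ.
have [wQ hs] := legal_move_step cd wP hPQ.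
have [R'' [B'' [hs2 hg2]]] := hg _ _ _ _ hgRB (step_perm hR hB hs).
have [T [hT h1 h2]] := step_legal_move cd hs2.
have [wT _] := legal_move_step cd wQ hT.
by exists T; split=> //; split=> //; exists R'', B''.
Qed.

Lemma heights_initial c d p q : c <> d ->
  heights c (initial_position c d p q) = ones p /\
  heights d (initial_position c d p q) = ones q.
Proof.
move=> cd; have ncd : (c == d) = false by apply/eqP.
have ndc : (d == c) = false by rewrite eq_sym.
rewrite /heights /initial_position !filter_cat !filter_nseq !map_cat !map_nseq /=.
by rewrite !(inj_eq Some_inj) !eqxx ncd ndc /=; split; rewrite ?mul1n ?mul0n ?cats0.
Qed.

Lemma nonempty_initial c d p q : nonempty (initial_position c d p q).
Proof. by rewrite /nonempty all_cat !all_nseq !orbT. Qed.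

Lemma alice_wins g c d p q R' B' : c <> d -> answered g ->
  step (ones p) (ones q) R' B' -> g R' B' ->
  has_winning_strategy Alice (initial_position c d p q).
Proof.
move=> cd hg hs hgg; apply: (kernel_winning (kernel_lift cd hg)).
have [h1 h2] := heights_initial p q cd; rewrite -h1 -h2 in hs.
have [T [hT q1 q2]] := step_legal_move cd hs.
exists T; split=> //; split; last by exists R', B'.
by have [] := legal_move_step cd (nonempty_initial c d p q) hT.
Qed.

Lemma bob_wins c d p q : c <> d -> 3 <= p -> p <= q -> ~~ odd (p + q) ->
  has_winning_strategy Bob (initial_position c d p q).
Proof.
move=> cd p3 pq ev.
apply: (kernel_winning (kernel_lift cd (good_or_start_answered p3 pq ev))).
have [h1 h2] := heights_initial p q cd.
split; first by split; [exact: nonempty_initial|exists (ones p), (ones q); rewrite h1 h2; split=> //; right].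
have hs : step (heights c (initial_position c d p q)) (heights d (initial_position c d p q))
    (2 :: ones p.-2) (ones q).
  by rewrite h1 h2; apply: (step_merge_l (x := 1) (y := 1) (r := ones p.-2)) => //; perms.
by have [T [hT _ _]] := step_legal_move cd hs; move/(_ _ hT).
Qed.

Theorem theorem1 (c d : color) (p q : nat) (hcd : c <> d)
    (hp : 1 <= p) (hpq : p <= q) :
  (has_winning_strategy Bob (initial_position c d p q)
     <-> ~~ odd (p + q) /\ 3 <= p)
  /\
  (~ (~~ odd (p + q) /\ 3 <= p) ->
     has_winning_strategy Alice (initial_position c d p q)).
Proof.
have alice : ~ (~~ odd (p + q) /\ 3 <= p) ->
    has_winning_strategy Alice (initial_position c d p q).
  move=> h; case: (boolP (odd (p + q))) => od.
    case: (eqVneq p 1) => p1.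
      subst p; apply: (alice_wins (R' := [:: 2]) (B' := ones q.-1) hcd good_answered).
        by apply: (step_cross_l (x := 1) (r := [::]) (b := ones q.-1)) => //; perms.
      by lone.
    case: (eqVneq p 2) => p2.
      subst p; apply: (alice_wins (R' := [:: 2]) (B' := ones q) hcd good_answered).
        exact: (step_merge_l (x := 1) (y := 1) (r := [::])).
      by lone.
    (* The right giant has height 1, so [odd_giants] asks for [p - 2 < q - 1], which follows from
       [p <= q]. *)
    apply: (alice_wins (R' := 2 :: ones p.-2) (B' := 1 :: ones q.-1) hcd good_answered).
      by apply: (step_merge_l (x := 1) (y := 1) (r := ones p.-2)) => //; perms.
    by oddg.
  have [?|?] : p = 1 \/ p = 2 by lia.
    (* Capturing the only chip of its color leaves [q] stacks of one color, an odd number. *)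
    subst p; apply: (alice_wins (R' := [::]) (B' := 2 :: ones q.-1) hcd merged_answered).
      by apply: (step_cross_r (x := 1) (r := [::]) (b := ones q.-1)) => //; perms.
    by left; left; rewrite /= size_nseq; split=> //; lia.
  subst p; apply: (alice_wins (R' := [:: 2]) (B' := ones q) hcd merged_answered).
    exact: (step_merge_l (x := 1) (y := 1) (r := [::])).
  by left; right; exists q; split=> //; lia.
split=> //; split=> [bob|[ev p3]]; last exact: bob_wins.
case: (boolP (~~ odd (p + q) && (3 <= p))) => [/andP[]//|/andP nh].
by case: (not_both_win (alice nh) bob).
Qed.
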